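(* Let $r \ge 3$. There exists $t_0=t_0(r)$ such that for every integer $t\ge t_0$ the following holds. Suppose that $G \subseteq \mathbb{N}^{(r)}$ is an $r$-graph with $\binom{t-1}{r} \le |G| \le \binom{t}{r}$ that maximises the Lagrangian among $r$-graphs with $|G|$ edges, and suppose that $w$ is a maximal weighting of $G$ which is decreasing and satisfies $w(x) > 0$ for every non-isolated vertex $x$ of $G$. Then $G \subseteq [t]^{(r)}$.
   Context: $\mathbb{N}^{(r)}$ is the set of $r$-subsets of $\mathbb{N}=\{1,2,\dots\}$ and $[t]^{(r)}$ the set of $r$-subsets of $[t]=\{1,\dots,t\}$. An $r$-graph is a finite subset of $\mathbb{N}^{(r)}$; a non-isolated vertex is an element lying in some edge. A weighting of $\mathbb{N}$ is $w:\mathbb{N}\to[0,\infty)$ with $\sum_x w(x)=1$; $w(G)=\sum_{e\in G}\prod_{x\in e}w(x)$; the Lagrangian is $\lambda(G)=\max_w w(G)$, and $w$ is a maximal weighting of $G$ if $w(G)=\lambda(G)$. A weighting is decreasing if $w(i)\ge w(j)$ whenever $i<j$. *)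

(* Defs.v *)
From HB Require Import structures.
From mathcomp Require Import all_boot all_order all_algebra.
From mathcomp Require Import finmap.
From mathcomp Require Import all_classical all_reals all_analysis.
Set Implicit Arguments. Unset Strict Implicit. Unset Printing Implicit Defensive.
Import Order.TTheory GRing.Theory Num.Theory.
Import numFieldNormedType.Exports.
Local Open Scope classical_set_scope.
Local Open Scope ring_scope.
Local Open Scope fset_scope.

(* An r-graph: a finite set of r-subsets of N = {1,2,...} (0 is excluded). *)
Definition is_rgraph (r : nat) (G : {fset {fset nat}}) : Prop :=
  forall e, e \in G -> #|` e| = r /\ 0%N \notin e.

(* A weighting of N = {1,2,...}: nonnegative, total mass 1.  It is encoded as a
   function on nat with the dummy value w 0 = 0. *)
Definition weighting (R : realType) (w : nat -> R) : Prop :=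
  w 0%N = 0 /\ (forall x, 0 <= w x) /\ (series w @ \oo --> (1 : R)).

Definition wgt (R : realType) (w : nat -> R) (G : {fset {fset nat}}) : R :=
  \sum_(e <- G) \prod_(x <- e) w x.

(* Lagrangian: max (here: sup, which is attained) of w(G) over weightings *)
Definition lagrangian (R : realType) (G : {fset {fset nat}}) : R :=
  sup [set wgt w G | w in [set w : nat -> R | weighting w]].

Definition decreasing_w (R : realType) (w : nat -> R) : Prop :=
  forall i j : nat, (1 <= i)%N -> (i < j)%N -> w j <= w i.

Definition nonisolated (G : {fset {fset nat}}) (x : nat) : Prop :=
  exists2 e, e \in G & x \in e.

Definition within_t (t : nat) (G : {fset {fset nat}}) : Prop :=
  forall e, e \in G -> forall x, x \in e -> (1 <= x <= t)%N.

(* Main.v *)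
Require Import Defs.
From mathcomp Require Import all_boot all_order all_algebra.
From mathcomp Require Import finmap.
From mathcomp Require Import all_classical all_reals all_analysis.
From mathcomp Require Import ring lra zify.
Set Implicit Arguments.
Unset Strict Implicit.
Unset Printing Implicit Defensive.
Import Order.TTheory GRing.Theory Num.Theory.
Import numFieldNormedType.Exports.
Local Open Scope fset_scope.
Local Open Scope ring_scope.

(** Let [T] be the largest vertex of [G], put [n = t - 1], and suppose [T > t].  Maximality
    forces the Lagrangian to be at least [(1 - O(1/n)) / r!], and the Lagrange condition says
    that the link of every vertex has weight [r] times the Lagrangian.  On the other hand
    [r! w(G)] is at most the probability that [r] independent samples from [w] are distinct,
    which is [1 - C(r, 2) \sum_x w x ^ 2] up to lower order terms; hence
    [\sum_x w x ^ 2 <= 1 / (n - O(1))].  By Cauchy-Schwarz every degree is at least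
    [(n - O(1)) n ^ (r - 2) / (r - 1)!], so that [T <= n + O(1)] by counting edges, and for a
    constant [B] the weight [w (T - B)] has order at least [1/n].
    Now replace the edges through [T] by as many missing edges inside [[1, T - 1]], of which
    there are enough because [|G| <= C(T - 1, r)].  After rescaling this loses only
    [O(w T ^ 2)], since the first order terms cancel.  All but [O(n ^ (r - 2))] of the new
    edges meet the last [B] vertices at most once, so the gain is at least a constant multiple
    of [w T].  As [w T = O(1/n)], the gain exceeds the loss for large [n]. *)

Section ConstantBigops.
Variables (I : choiceType) (A : {fset I}).

Lemma sumr_const_fset (V : nmodType) (c : V) : \sum_(i <- A) c = c *+ #|` A|.
Proof. by rewrite big_const_seq count_predT iter_addr_0. Qed.

Lemma prodr_const_fset (S : pzSemiRingType) (c : S) : \prod_(i <- A) c = c ^+ #|` A|.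
Proof. by rewrite big_const_seq count_predT iter_mulr_1. Qed.

End ConstantBigops.

Lemma big_mem_fsetI (T : Type) (idx : T) (op : Monoid.com_law idx) (I : choiceType)
    (A B : {fset I}) (f : I -> T) :
  \big[op/idx]_(i <- A | i \in B) f i = \big[op/idx]_(i <- A `&` B) f i.
Proof. by rewrite big_fset_condE; apply: eq_fbigl => i; rewrite !inE. Qed.

Lemma big_notin_fsetD (T : Type) (idx : T) (op : Monoid.com_law idx) (I : choiceType)
    (A B : {fset I}) (f : I -> T) :
  \big[op/idx]_(i <- A | i \notin B) f i = \big[op/idx]_(i <- A `\` B) f i.
Proof. by rewrite big_fset_condE; apply: eq_fbigl => i; rewrite !inE andbC. Qed.

Lemma sumr_fsetD (V : zmodType) (I : choiceType) (A B : {fset I}) (f : I -> V) : B `<=` A ->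
  \sum_(i <- A `\` B) f i = \sum_(i <- A) f i - \sum_(i <- B) f i.
Proof.
move=> BA; rewrite [X in _ = X - _](bigID (mem B)) /= big_mem_fsetI big_notin_fsetD.
by rewrite (fsetIidPr BA) addrAC subrr add0r.
Qed.

Section FsetSums.
Variables (R : numDomainType) (I : choiceType).
Implicit Types (A B : {fset I}) (f g : I -> R) (c : R).

Lemma ler_sum_fset A f g : {in A, forall i, f i <= g i} ->
  \sum_(i <- A) f i <= \sum_(i <- A) g i.
Proof. by move=> fg; rewrite big_seq [leRHS]big_seq; apply: ler_sum. Qed.

Lemma cardfs_mul_le_sum A c f : {in A, forall i, c <= f i} ->
  #|` A|%:R * c <= \sum_(i <- A) f i.
Proof. by rewrite mulr_natl -sumr_const_fset; exact: ler_sum_fset. Qed.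

Lemma sum_le_cardfs_mul A c f : {in A, forall i, f i <= c} ->
  \sum_(i <- A) f i <= #|` A|%:R * c.
Proof. by rewrite mulr_natl -sumr_const_fset; exact: ler_sum_fset. Qed.

Lemma ler_sum_fsubset A B f : (forall i, 0 <= f i) -> A `<=` B ->
  \sum_(i <- A) f i <= \sum_(i <- B) f i.
Proof.
move=> f0 AB; rewrite [leRHS](bigID (mem A)) /= big_mem_fsetI (fsetIidPr AB).
by rewrite lerDl sumr_ge0.
Qed.

End FsetSums.

Lemma fset_between (K : choiceType) (A B : {fset K}) k : A `<=` B ->
  (#|` A| <= k <= #|` B|)%N -> exists C : {fset K}, [/\ A `<=` C, C `<=` B & #|` C| = k].
Proof.
move=> AB /andP[Ak kB].
pose D := [fset x in take (k - #|` A|) (enum_fset (B `\` A))].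
have DBA : D `<=` B `\` A by apply/fsubsetP => x; rewrite in_fset /= => /mem_take.
exists (A `|` D); split; first exact: fsubsetUl.
  by rewrite fsubUset AB (fsubset_trans DBA) // fsubDset fsubsetUr.
rewrite cardfsU (_ : A `&` D = fset0) ?cardfs0 ?subn0; last first.
  apply/eqP; rewrite -fsubset0; apply/fsubsetP => x; rewrite in_fsetI => /andP[xA xD].
  by have := fsubsetP DBA x xD; rewrite in_fsetD xA.
rewrite card_fseq undup_id ?take_uniq ?fset_uniq // size_take cardfsDS //.
by case: ltnP; lia.
Qed.

Section Hypergraphs.
Variable K : choiceType.
Implicit Types (V e : {fset K}) (H : {fset {fset K}}) (x : K) (k : nat).

Definition ksets V k : {fset {fset K}} := [fset e in fpowerset V | #|` e| == k].

Definition star x H : {fset {fset K}} := [fset e in H | x \in e].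

Definition deletion x H : {fset {fset K}} := [fset e in H | x \notin e].

Definition link x H : {fset {fset K}} := [fset e `\ x | e in star x H].

Lemma in_ksets V k e : (e \in ksets V k) = (e `<=` V) && (#|` e| == k).
Proof. by rewrite !inE /= fpowersetE. Qed.

Lemma in_star x H e : (e \in star x H) = (e \in H) && (x \in e).
Proof. by rewrite !inE. Qed.

Lemma in_deletion x H e : (e \in deletion x H) = (e \in H) && (x \notin e).
Proof. by rewrite !inE. Qed.

Lemma ksets0 V : ksets V 0 = [fset fset0].
Proof.
apply/fsetP => e; rewrite in_ksets inE cardfs_eq0.
by case: eqP => [->|]; rewrite ?fsub0set ?andbF.
Qed.

Lemma ksets_subset V V' k : V `<=` V' -> ksets V k `<=` ksets V' k.
Proof.
move=> VV'; apply/fsubsetP => e; rewrite !in_ksets => /andP[eV ->].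
by rewrite (fsubset_trans eV).
Qed.

Lemma card_ksets V k : #|` ksets V k| = 'C(#|` V|, k).
Proof.
rewrite [in RHS]cardfE -(card_draws V k).
pose f (Y : {set V}) : {fset K} := [fset val y | y in Y].
have finj : injective f.
  by move=> A B /fsetP E; apply/setP => a; have := E (val a); rewrite !inE.
have card_f (Y : {set V}) : #|` f Y| = #|Y|.
  by rewrite card_imfset /= -?cardE //; exact: val_inj.
have -> : ksets V k = [fset f Y | Y in [set A : {set V} | #|A| == k]].
  apply/fsetP => e; rewrite in_ksets; apply/andP/imfsetP => [[eV ek]|[Y]] /=.
    have E : e = f [set x : V | val x \in e].
      apply/fsetP => a; apply/idP/imfsetP => /= [ae|[x + ->]]; last by rewrite inE.
      by exists [` fsubsetP eV a ae]; rewrite ?inE.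
    by exists [set x : V | val x \in e]; rewrite // inE -card_f -E.
  rewrite inE => Yk ->; rewrite card_f; split=> //.
  by apply/fsubsetP => a /imfsetP[y _ ->]; exact: valP.
by rewrite card_imfset //= -cardE.
Qed.

Lemma link_inj x H : {in star x H &, injective (fun e : {fset K} => e `\ x)}.
Proof.
move=> e f; rewrite !in_star => /andP[_ xe] /andP[_ xf] E.
by rewrite -(fsetD1K xe) E fsetD1K.
Qed.

Lemma card_link_deletion x H : (#|` link x H| + #|` deletion x H| = #|` H|)%N.
Proof.
rewrite /link card_in_imfset /=; last exact: link_inj.
by rewrite !card_fset_sum1 [RHS](big_fsetID _ (fun e : {fset K} => x \in e)).
Qed.

Lemma notin_link x H f : f \in link x H -> x \notin f.
Proof. by move=> /imfsetP[e _ ->]; rewrite !inE eqxx. Qed.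

Lemma link_ksets V x k : x \in V -> link x (ksets V k.+1) = ksets (V `\ x) k.
Proof.
move=> xV; apply/fsetP => f; apply/imfsetP/idP => [[e]|] /=.
  rewrite in_star !in_ksets => /andP[/andP[eV ek] xe] ->.
  by move: ek; rewrite (cardfsD1 x) xe add1n eqSS => ->; rewrite fsetSD.
rewrite in_ksets fsubsetD1 => /andP[/andP[fV xf] fk].
exists (x |` f); last by rewrite fsetU1K.
by rewrite in_star in_ksets fsubUset fsub1set xV fV cardfsU1 xf add1n eqSS fk fset1U1.
Qed.

Lemma deletion_ksets V x k : deletion x (ksets V k) = ksets (V `\ x) k.
Proof. by apply/fsetP => e; rewrite in_deletion !in_ksets fsubsetD1 andbAC. Qed.

Lemma link_subset x H H' : H `<=` H' -> link x H `<=` link x H'.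
Proof.
move=> /fsubsetP HH'; apply/fsubsetP => f /imfsetP[e /=].
rewrite in_star => /andP[/HH' eH' xe] ->; apply/imfsetP; exists e => //=.
by rewrite in_star eH'.
Qed.

Lemma deletion_subset x H H' : H `<=` H' -> deletion x H `<=` deletion x H'.
Proof.
by move=> /fsubsetP HH'; apply/fsubsetP => e; rewrite !in_deletion => /andP[/HH' -> ->].
Qed.

Lemma link_subset_ksets V x H k : x \in V -> H `<=` ksets V k.+1 ->
  link x H `<=` ksets (V `\ x) k.
Proof. by move=> /link_ksets <-; exact: link_subset. Qed.

Lemma deletion_subset_ksets V x H k : H `<=` ksets V k ->
  deletion x H `<=` ksets (V `\ x) k.
Proof. by rewrite -deletion_ksets; exact: deletion_subset. Qed.

(* Since [G] has at most as many edges as the complete hypergraph on [V `\ x], the latter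
   misses at least as many sets as there are edges of [G] through [x]. *)
Lemma exists_replacement_edges V x G k : x \in V -> G `<=` ksets V k ->
  (#|` G| <= 'C(#|` V|.-1, k))%N ->
  exists2 F : {fset {fset K}}, F `<=` ksets (V `\ x) k `\` G & #|` F| = #|` link x G|.
Proof.
move=> xV GV; have -> : #|` V|.-1 = #|` V `\ x| by rewrite (cardfsD1 x) xV.
rewrite -card_ksets -(card_link_deletion x G) => Gle.
have cap_le : (#|` ksets (V `\ x) k `&` G| <= #|` deletion x G|)%N.
  apply/fsubset_leq_card/fsubsetP => e; rewrite in_fsetI in_ksets fsubsetD1 in_deletion.
  by move=> /andP[/andP[/andP[_ ->] _] ->].
have [|F [_ FV cF]] := fset_between (k := #|` link x G|) (fsub0set (ksets (V `\ x) k `\` G)).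
  by rewrite cardfs0 leq0n cardfsD -[leqLHS](addnK #|` deletion x G|) leq_sub.
by exists F.
Qed.

End Hypergraphs.

Section Weights.
Variable R : realType.
Implicit Types (v : nat -> R) (x k : nat) (V e : {fset nat}) (H : {fset {fset nat}}).

Lemma eq_wgt v v' H : (forall e, e \in H -> {in e, v =1 v'}) -> wgt v H = wgt v' H.
Proof.
by move=> vv'; apply: eq_big_seq => e eH; apply: eq_big_seq; apply: vv'.
Qed.

Lemma wgt_ge0 v H : (forall x, 0 <= v x) -> 0 <= wgt v H.
Proof. by move=> v0; apply: sumr_ge0 => e _; apply: prodr_ge0. Qed.

Lemma wgt_subset v H H' : (forall x, 0 <= v x) -> H `<=` H' -> wgt v H <= wgt v H'.
Proof. by move=> v0; apply: ler_sum_fsubset => e; apply: prodr_ge0. Qed.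

Lemma wgt1 H : wgt (fun=> 1 : R) H = #|` H|%:R.
Proof. by rewrite /wgt (eq_bigr (fun=> 1)) ?sumr_const_fset // => e _; rewrite big1. Qed.

Lemma wgtZ (c : R) v V k H : H `<=` ksets V k -> wgt (fun x => c * v x) H = c ^+ k * wgt v H.
Proof.
move=> /fsubsetP HV; rewrite /wgt big_distrr /=; apply: eq_big_seq => e /HV.
rewrite in_ksets => /andP[_ /eqP <-].
by rewrite big_split /= prodr_const_fset.
Qed.

Lemma wgtU v H H' : [disjoint H & H']%fset -> wgt v (H `|` H') = wgt v H + wgt v H'.
Proof.
move=> dHH'; rewrite /wgt (big_fsetID _ (mem H)) /=; congr (_ + _).
  by apply: eq_fbigl => e; rewrite !inE /=; case: (e \in H); rewrite ?andbF ?orbT.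
apply: eq_fbigl => e; rewrite !inE /=.
have := fdisjointP dHH' e; case: (e \in H) => //= [/(_ isT)/negbTE ->|_] //.
by rewrite andbT.
Qed.

Lemma wgt_star v x H : wgt v (star x H) = v x * wgt v (link x H).
Proof.
rewrite /wgt [in RHS]big_imfset /=; last exact: link_inj.
rewrite big_distrr /=; apply: eq_big_seq => e.
by rewrite in_star => /andP[_ xe]; rewrite (big_fsetD1 x).
Qed.

Lemma wgt_deletion_link v x H :
  wgt v H = wgt v (deletion x H) + v x * wgt v (link x H).
Proof. by rewrite -wgt_star addrC [LHS](big_fsetID _ (fun e : {fset nat} => x \in e)). Qed.

Definition shift v x (h : R) : nat -> R := fun y => if y == x then v x + h else v y.

Lemma sum_shift v x h V : x \in V -> \sum_(y <- V) shift v x h y = \sum_(y <- V) v y + h.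
Proof.
move=> xV; rewrite !(big_fsetD1 x xV) /= {1}/shift eqxx addrAC; congr (_ + _ + _).
by apply: eq_big_seq => y; rewrite !inE /shift => /andP[/negPf ->].
Qed.

Lemma wgt_shift v x h H : wgt (shift v x h) H = wgt v H + h * wgt v (link x H).
Proof.
have shift_off H' : (forall e, e \in H' -> x \notin e) -> wgt (shift v x h) H' = wgt v H'.
  move=> H'x; apply: eq_wgt => e /H'x xe y ye; rewrite /shift.
  by case: eqP ye => // ->; rewrite (negPf xe).
rewrite !(wgt_deletion_link _ x H) !shift_off.
- by rewrite /shift eqxx; ring.
- exact: notin_link.
- by move=> e; rewrite in_deletion => /andP[].
Qed.

Lemma sum_wgt_link v V k H : H `<=` ksets V k ->
  \sum_(x <- V) v x * wgt v (link x H) = k%:R * wgt v H.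
Proof.
move=> /fsubsetP HV; under eq_bigr do rewrite -wgt_star /wgt -big_fset_condE big_mkcond /=.
rewrite exchange_big /= big_distrr /=; apply: eq_big_seq => e /HV.
rewrite in_ksets => /andP[eV /eqP ek].
by rewrite -big_mkcond big_mem_fsetI sumr_const_fset (fsetIidPr eV) ek mulr_natl.
Qed.

Lemma wgt_le_mass v V k H : (forall x, 0 <= v x) -> H `<=` ksets V k ->
  k`!%:R * wgt v H <= (\sum_(x <- V) v x) ^+ k.
Proof.
move=> v0; elim: k V H => [|k IH] V H HV.
  rewrite fact0 mul1r expr0; apply: le_trans (wgt_subset v0 HV) _.
  by rewrite ksets0 /wgt big_seq_fset1 big_seq_fset0.
rewrite factS natrM mulrAC -(sum_wgt_link _ HV) mulr_suml exprS mulr_suml.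
apply: ler_sum_fset => x xV; rewrite -mulrA; apply: ler_wpM2l => //; rewrite mulrC.
apply: le_trans (IH _ _ (link_subset_ksets xV HV)) _.
by rewrite lerXn2r ?nnegrE ?sumr_ge0 // ler_sum_fsubset // fsubD1set.
Qed.

(* For a probability vector [v] on [V]: the probability that [k] independent samples
   are pairwise distinct. *)
Definition distinct_wgt v V k : R := k`!%:R * wgt v (ksets V k).

Lemma distinct_wgt0 v V : distinct_wgt v V 0 = 1.
Proof. by rewrite /distinct_wgt ksets0 /wgt big_seq_fset1 big_seq_fset0 fact0 mulr1. Qed.

Lemma distinct_wgtS v V k :
  distinct_wgt v V k.+1 = \sum_(x <- V) v x * distinct_wgt v (V `\ x) k.
Proof.
rewrite /distinct_wgt factS natrM mulrAC -(sum_wgt_link _ (fsubset_refl _)) mulr_suml.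
apply: eq_big_seq => x xV; rewrite link_ksets // -mulrA.
by rewrite [_ * k`!%:R]mulrC.
Qed.

Lemma distinct_wgtD1 v V x k : x \in V ->
  distinct_wgt v V k.+1 =
  distinct_wgt v (V `\ x) k.+1 + k.+1%:R * v x * distinct_wgt v (V `\ x) k.
Proof.
move=> xV; rewrite /distinct_wgt (wgt_deletion_link v x) link_ksets // deletion_ksets.
by rewrite factS natrM; ring.
Qed.

Section ProbabilityVector.
Variables (v : nat -> R) (V : {fset nat}) (b : R).
Hypotheses (v_ge0 : forall x, 0 <= v x) (v_mass : \sum_(x <- V) v x = 1).
Hypothesis v_le : {in V, forall x, v x <= b}.
Local Notation P := (\sum_(x <- V) v x ^+ 2).

Lemma distinct_wgt_le1 V' k : V' `<=` V -> distinct_wgt v V' k <= 1.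
Proof.
move=> V'V; apply: le_trans (wgt_le_mass v_ge0 (fsubset_refl _)) _.
by rewrite exprn_ile1 ?sumr_ge0 // -v_mass ler_sum_fsubset.
Qed.

Lemma distinct_wgt1 : distinct_wgt v V 1 = 1.
Proof. by rewrite distinct_wgtS -[RHS]v_mass; under eq_bigr do rewrite distinct_wgt0 mulr1. Qed.

Lemma distinct_wgtSS k : distinct_wgt v V k.+2 =
  distinct_wgt v V k.+1 - k.+1%:R * \sum_(x <- V) v x ^+ 2 * distinct_wgt v (V `\ x) k.
Proof.
rewrite distinct_wgtS -[X in _ = X - _]mul1r -[X in _ = X * _ - _]v_mass.
rewrite mulr_suml mulr_sumr -sumrB; apply: eq_big_seq => x xV.
by rewrite (distinct_wgtD1 _ _ xV); ring.
Qed.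

Let b_ge0 : 0 <= b.
Proof.
have [V0|[x xV]] := fset_0Vmem V; last exact: le_trans (v_le xV).
by move: v_mass; rewrite V0 big_seq_fset0 => /eqP; rewrite eq_sym oner_eq0.
Qed.

Lemma distinct_wgt_ge k : 1 - 'C(k, 2)%:R * b <= distinct_wgt v V k.
Proof.
case: k => [|k]; first by rewrite distinct_wgt0 mul0r subr0.
elim: k => [|k IH]; first by rewrite mul0r subr0 distinct_wgt1.
have collision_le : \sum_(x <- V) v x ^+ 2 * distinct_wgt v (V `\ x) k <= b.
  rewrite -[leRHS]mulr1 -[X in _ <= _ * X]v_mass mulr_sumr.
  apply: ler_sum_fset => x /v_le vxb; have := distinct_wgt_le1 k (fsubD1set V x).
  by move=> /(ler_piMr (sqr_ge0 (v x))) /le_trans -> //; rewrite expr2 ler_wpM2r.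
rewrite distinct_wgtSS binS bin1 natrD.
by have := ler_wpM2l (ler0n R k.+1) collision_le; lra.
Qed.

Lemma distinct_wgtD1_ge x k : x \in V -> 1 - 'C(k.+1, 2)%:R * b <= distinct_wgt v (V `\ x) k.
Proof.
case: k => [|k] xV; first by rewrite distinct_wgt0 mul0r subr0.
have := distinct_wgt_ge k.+1; rewrite (distinct_wgtD1 _ _ xV) (binS k.+1) bin1 natrD.
have : v x * distinct_wgt v (V `\ x) k <= b.
  by rewrite (le_trans (ler_piMr _ (distinct_wgt_le1 _ (fsubD1set _ _)))) ?v_le.
by move=> /(ler_wpM2l (ler0n R k.+1)); lra.
Qed.

Lemma distinct_wgt_le k :
  distinct_wgt v V k <= 1 - 'C(k, 2)%:R * (1 - 'C(k.-1, 2)%:R * b) * P.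
Proof.
have P_ge0 : 0 <= P by apply: sumr_ge0 => x _; exact: sqr_ge0.
case: k => [|k]; first by rewrite distinct_wgt0 !mul0r subr0.
elim: k => [|k IH]; first by rewrite !mul0r subr0 distinct_wgt1.
set c : R := 'C(k.+1, 2)%:R.
have collision_ge : P * (1 - c * b) <= \sum_(x <- V) v x ^+ 2 * distinct_wgt v (V `\ x) k.
  rewrite mulr_suml; apply: ler_sum_fset => x xV.
  by rewrite ler_wpM2l ?sqr_ge0 // distinct_wgtD1_ge.
have bin_mono : 'C(k, 2)%:R * (c * b * P) <= c * (c * b * P).
  by rewrite ler_wpM2r ?mulr_ge0 // ler_nat leq_bin2l.
rewrite distinct_wgtSS (binS k.+1) bin1 natrD -/c.
by have := ler_wpM2l (ler0n R k.+1) collision_ge; move: IH bin_mono; rewrite -/c /=; lra.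
Qed.

End ProbabilityVector.

End Weights.

Section RealInequalities.
Variable R : realDomainType.

Lemma bernoulli_ge (x : R) k : 0 <= x <= 1 -> 1 - k%:R * x <= (1 - x) ^+ k.
Proof.
move=> /andP[x0 x1]; elim: k => [|k IH]; first by rewrite expr0 mul0r subr0.
rewrite exprS; apply: le_trans (ler_wpM2l _ IH); last by rewrite subr_ge0.
have : 0 <= k%:R * x ^+ 2 by rewrite mulr_ge0 // sqr_ge0.
by rewrite -natr1; lra.
Qed.

Lemma bernoulli2_le (x : R) k : 0 <= x <= 1 ->
  (1 - x) ^+ k <= 1 - k%:R * x + 'C(k, 2)%:R * x ^+ 2.
Proof.
move=> /andP[x0 x1]; elim: k => [|k IH]; first by rewrite expr0 !mul0r subr0 addr0.
rewrite exprS; apply: le_trans (ler_wpM2l _ IH) _; first by rewrite subr_ge0.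
have : 0 <= 'C(k, 2)%:R * x ^+ 3 by rewrite mulr_ge0 // exprn_ge0.
by rewrite binS bin1 natrD -natr1; lra.
Qed.

Lemma sqr_sum_le_size (I : Type) (s : seq I) (a : I -> R) :
  (\sum_(i <- s) a i) ^+ 2 <= (size s)%:R * \sum_(i <- s) a i ^+ 2.
Proof.
elim: s => [|i s IH]; first by rewrite !big_nil expr0n mulr0.
rewrite !big_cons; set S := \sum_(j <- s) a j; set Q := \sum_(j <- s) a j ^+ 2.
have : 2 * a i * S <= (size s)%:R * a i ^+ 2 + Q.
  have : 0 <= \sum_(j <- s) (a i - a j) ^+ 2 by apply: sumr_ge0 => j _; exact: sqr_ge0.
  under eq_bigr do rewrite sqrrB.
  rewrite big_split sumrB /= -/Q big_const_seq count_predT iter_addr_0 -mulr_natl.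
  by rewrite sumrMnl -mulr_sumr -/S; lra.
by move: IH; rewrite -/S -/Q /= -natr1; lra.
Qed.

End RealInequalities.

Section Lagrangian.
Variable R : realType.
Implicit Types (v w : nat -> R) (r x : nat) (V : {fset nat}) (G H : {fset {fset nat}}).
Local Open Scope classical_set_scope.

Lemma fset_nat_bounded V : exists n, forall x, x \in V -> (x < n)%N.
Proof.
exists (\max_(x <- V) x).+1 => x xV; rewrite ltnS.
exact: (@leq_bigmax_seq _ _ xpredT id).
Qed.

Lemma sum_index_iota_fset v V n : (forall x, x \in V -> (x < n)%N) ->
  \sum_(0 <= i < n | i \in V) v i = \sum_(x <- V) v x.
Proof.
move=> Vn; rewrite -big_filter; apply/perm_big/uniq_perm.
- by rewrite filter_uniq ?iota_uniq.
- exact: fset_uniq.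
by move=> x; rewrite mem_filter mem_index_iota /=; apply: andb_idr => /Vn.
Qed.

Lemma weighting_mass_le1 w V : weighting w -> \sum_(x <- V) w x <= 1.
Proof.
move=> [_ [w0 ws]]; have [n /(sum_index_iota_fset w) <-] := fset_nat_bounded V.
apply: (@le_trans _ _ (series w n)).
  by rewrite big_mkcond; apply: ler_sum => i _; case: ifP.
rewrite -(cvg_lim _ ws) //; apply: nondecreasing_cvgn_le; last by apply/cvg_ex; exists 1.
by apply/nondecreasing_seqP => k; rewrite /series /= big_nat_recr //= lerDl.
Qed.

Lemma weighting_restrict v V : 0%N \notin V -> (forall x, 0 <= v x) ->
  \sum_(x <- V) v x = 1 -> weighting (fun x => if x \in V then v x else 0).
Proof.
move=> V0 v0 v1; split; first by rewrite (negPf V0).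
split=> [x|]; first by case: ifP.
have [n Vn] := fset_nat_bounded V; apply: cvg_near_cst; exists n => // m /= nm.
rewrite /series /= -big_mkcond sum_index_iota_fset // => x /Vn xn.
exact: leq_trans nm.
Qed.

Lemma wgt_le_lagrangian w H : weighting w -> wgt w H <= lagrangian R H.
Proof.
move=> ww; apply: ub_le_sup; last by exists w.
exists #|` H|%:R => _ [v vv <-]; rewrite -wgt1; apply: ler_sum => e _.
apply: ler_prod => x _; have [_ [-> _]] := vv.
by have := weighting_mass_le1 [fset x]%fset vv; rewrite big_seq_fset1.
Qed.

Section OnVertexSet.
Variables (V : {fset nat}) (r : nat) (G : {fset {fset nat}}).
Hypotheses (V0 : 0%N \notin V) (GV : (G `<=` ksets V r)%fset).

Lemma wgt_le_lagrangian_mass v : (forall x, 0 <= v x) -> 0 < \sum_(x <- V) v x ->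
  wgt v G <= lagrangian R G * (\sum_(x <- V) v x) ^+ r.
Proof.
set s := \sum_(x <- V) v x => v0 s0.
have sv0 x : 0 <= s^-1 * v x by rewrite mulr_ge0 // invr_ge0 ltW.
have := wgt_le_lagrangian G (weighting_restrict V0 sv0 _).
rewrite -mulr_sumr mulVf ?gt_eqF // => /(_ erefl).
rewrite (_ : wgt _ G = wgt (fun x => s^-1 * v x) G); last first.
  by apply: eq_wgt => e /(fsubsetP GV); rewrite in_ksets => /andP[/fsubsetP eV _] x /eV /= ->.
by rewrite (wgtZ _ _ GV) exprVn mulrC ler_pdivrMr ?exprn_gt0.
Qed.

Lemma maximal_weighting_mass w : (0 < r)%N -> weighting w -> wgt w G = lagrangian R G ->
  0 < lagrangian R G -> \sum_(x <- V) w x = 1.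
Proof.
move=> r0 ww wG l0; have [_ [w0 _]] := ww; apply: le_anti; rewrite weighting_mass_le1 //=.
have s_ge0 : 0 <= \sum_(x <- V) w x by rewrite sumr_ge0.
have s_gt0 : 0 < \sum_(x <- V) w x.
  rewrite lt0r s_ge0 andbT; apply/eqP => s0; have := wgt_le_mass w0 GV.
  rewrite s0 expr0n gtn_eqF //= wG leNgt pmulr_lgt0 //.
  by rewrite ltr0n fact_gt0.
have := wgt_le_lagrangian_mass w0 s_gt0; rewrite wG ler_pMr //.
by rewrite expr_ge1.
Qed.

(* Moving the mass at [x] from [w x] to [w x + h] changes the weight of [G] linearly, while
   by homogeneity it cannot exceed [(1 + h) ^ r] times the Lagrangian. *)
Lemma wgt_link_maximal w x : (forall y, 0 <= w y) -> \sum_(y <- V) w y = 1 ->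
  wgt w G = lagrangian R G -> x \in V -> 0 < w x ->
  wgt w (link x G) = r%:R * lagrangian R G.
Proof.
move=> w0 w1 wG xV wx; set l := lagrangian R G; set D := wgt w (link x G).
have perturbed (h : R) : - w x < h -> l + h * D <= l * (1 + h) ^+ r.
  move=> hx; have wx1 : w x <= 1 by rewrite -w1 (big_fsetD1 x xV) lerDl sumr_ge0.
  have mass : \sum_(y <- V) shift w x h y = 1 + h by rewrite sum_shift // w1.
  rewrite -[l]wG -wgt_shift wG -mass; apply: wgt_le_lagrangian_mass; last by rewrite mass; lra.
  by move=> y; rewrite /shift; case: ifP => // _; lra.
pose f : R -> R := l \*: (cst 1 + id) ^+ r - D \*: id.
have fE h : f h = l * (1 + h) ^+ r - D * h by rewrite /f /= !fctE.
have f_deriv (t : R) : is_derive t 1 f (l * (r%:R * (1 + t) ^+ r.-1) - D).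
  by apply: is_derive_eq; rewrite add0r /GRing.scale /= !mulr1.
have f_min : is_derive (0 : R) 1 f 0.
  apply: (@derive1_at_min _ f (- w x) (w x)); rewrite ?in_itv /=; [lra| |lra|].
    by move=> t _; have [] := f_deriv t.
  by move=> t; rewrite in_itv /= !fE addr0 expr1n => /andP[/perturbed]; lra.
have := @derive_val _ _ _ _ _ _ _ f_min; rewrite (@derive_val _ _ _ _ _ _ _ (f_deriv 0)).
by rewrite addr0 expr1n; lra.
Qed.

End OnVertexSet.

End Lagrangian.

Definition segment (n : nat) : {fset nat} := [fset x in iota 1 n].

Lemma in_segment n x : (x \in segment n) = (0 < x <= n)%N.
Proof. by rewrite in_fset [LHS]mem_iota add1n ltnS. Qed.

Lemma card_segment n : #|` segment n| = n.
Proof. by rewrite card_fseq undup_id ?iota_uniq // size_iota. Qed.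

Lemma segment_subset m n : (m <= n)%N -> segment m `<=` segment n.
Proof.
move=> mn; apply/fsubsetP => x; rewrite !in_segment => /andP[-> /=].
by move=> /leq_trans ->.
Qed.

Lemma is_rgraph_ksets (V : {fset nat}) r (H : {fset {fset nat}}) :
  0%N \notin V -> H `<=` ksets V r -> is_rgraph r H.
Proof.
move=> V0 /fsubsetP HV e /HV; rewrite in_ksets => /andP[/fsubsetP eV /eqP ek].
by split=> //; apply: contra V0; apply: eV.
Qed.

Definition lagrangian_maximal (R : realType) r (G : {fset {fset nat}}) :=
  forall H : {fset {fset nat}}, is_rgraph r H -> #|` H| = #|` G| ->
    lagrangian R H <= lagrangian R G.

Section ExtremalLagrangian.
Variable R : realType.
Implicit Types (V : {fset nat}) (r n : nat) (G H F : {fset {fset nat}}) (w : nat -> R).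

Lemma lagrangian_complete_ge V r H : (0 < #|` V|)%N -> 0%N \notin V -> ksets V r `<=` H ->
  1 - 'C(r, 2)%:R / #|` V|%:R <= r`!%:R * lagrangian R H.
Proof.
set b : R := _^-1 => V_gt0 V0 VH; pose u : nat -> R := fun=> b.
have b0 : 0 <= b by rewrite invr_ge0.
have u_mass : \sum_(x <- V) u x = 1.
  by rewrite sumr_const_fset -mulr_natr mulVf // pnatr_eq0 -lt0n.
apply: le_trans (distinct_wgt_ge (fun=> b0) u_mass (fun _ _ => lexx _) r) _.
rewrite ler_wpM2l //.
have restricted := weighting_restrict V0 (fun=> b0) u_mass.
apply: le_trans (wgt_le_lagrangian H restricted).
rewrite (_ : wgt u _ = wgt (fun x => if x \in V then u x else 0) (ksets V r)).
  by apply: wgt_subset VH; case: restricted => _ [].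
by apply: eq_wgt => e; rewrite in_ksets => /andP[/fsubsetP eV _] x /eV /= ->.
Qed.

Lemma extremal_lagrangian_ge r n G : (0 < n)%N ->
  ('C(n, r) <= #|` G| <= 'C(n.+1, r))%N -> lagrangian_maximal R r G ->
  1 - 'C(r, 2)%:R / n%:R <= r`!%:R * lagrangian R G.
Proof.
move=> n0 Gn Gmax.
have [|H [nH Hn cH]] := fset_between (ksets_subset r (segment_subset (leqnSn n))) (k := #|` G|).
  by rewrite !card_ksets !card_segment.
have segment0 m : 0%N \notin segment m by rewrite in_segment.
apply: le_trans (ler_wpM2l _ (Gmax H (is_rgraph_ksets (segment0 _) Hn) cH)); last by [].
by have := lagrangian_complete_ge _ (segment0 n) nH; rewrite card_segment; apply.
Qed.

(* Deleting the star of [x] costs [w x] times its link, which by the Lagrange condition is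
   recovered to first order by rescaling the remaining mass [1 - w x]. *)
Lemma wgt_replacement_le V r G F w x : 0%N \notin V -> G `<=` ksets V r ->
  lagrangian_maximal R r G -> (forall y, 0 <= w y) -> \sum_(y <- V) w y = 1 ->
  wgt w G = lagrangian R G -> x \in V -> 0 < w x < 1 ->
  F `<=` ksets (V `\ x) r `\` G -> #|` F| = #|` link x G| ->
  wgt w F <= 'C(r, 2)%:R * w x ^+ 2 * lagrangian R G.
Proof.
move=> V0 GV Gmax w0 w1 wG xV /andP[wx_gt0 wx_lt1]; rewrite fsubsetD => /andP[FV FG] cF.
have Vx0 : 0%N \notin V `\ x by apply: contra V0; apply/fsubsetP/fsubD1set.
have dF : [disjoint deletion x G & F]%fset.
  apply: fdisjointWl (_ : deletion x G `<=` G) _; last by rewrite fdisjoint_sym.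
  by apply/fsubsetP => e; rewrite in_deletion => /andP[].
set H := deletion x G `|` F.
have HV : H `<=` ksets (V `\ x) r by rewrite fsubUset deletion_subset_ksets.
have cH : #|` H| = #|` G|.
  rewrite cardfsU (_ : deletion x G `&` F = fset0) ?cardfs0 ?subn0; last exact/eqP.
  by rewrite cF addnC card_link_deletion.
have mass : \sum_(y <- V `\ x) w y = 1 - w x.
  by rewrite sumr_fsetD ?fsub1set // w1 big_seq_fset1.
have l0 : 0 <= lagrangian R G by rewrite -wG wgt_ge0.
have := wgt_le_lagrangian_mass Vx0 HV w0; rewrite mass subr_gt0 => /(_ wx_lt1).
have rest0 : 0 <= (1 - w x) ^+ r by rewrite exprn_ge0 // subr_ge0 ltW.
move=> /le_trans /(_ (ler_wpM2r rest0 (Gmax H (is_rgraph_ksets Vx0 HV) cH))).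
have bern : (1 - w x) ^+ r <= 1 - r%:R * w x + 'C(r, 2)%:R * w x ^+ 2.
  by apply: bernoulli2_le; rewrite !ltW.
move=> /le_trans /(_ (ler_wpM2l l0 bern)).
have := wgt_deletion_link w x G.
by rewrite wgtU // (wgt_link_maximal V0 GV w0 w1 wG xV wx_gt0) wG; lra.
Qed.

End ExtremalLagrangian.

Section LightTail.
Variable R : realType.
Implicit Types (V U : {fset nat}) (k : nat) (F : {fset {fset nat}}) (w : nat -> R).

(* Giving the vertices of [U] weight [#|` V|] and the others weight 1 makes every such set
   weigh at least [#|` V| ^ j], while the total mass stays linear in [#|` V|]. *)
Lemma card_meeting_le V U F k j : U `<=` V -> F `<=` ksets V k -> (0 < #|` V|)%N ->
  (forall f, f \in F -> (j <= #|` f `&` U|)%N) ->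
  #|` F|%:R * #|` V|%:R ^+ j <= ((1 + #|` U|%:R) * #|` V|%:R) ^+ k :> R.
Proof.
move=> UV FV V_gt0 Fj; set N : R := #|` V|%:R.
have N1 : 1 <= N by rewrite ler1n.
pose z x : R := if x \in U then N else 1.
have z0 x : 0 <= z x by rewrite /z; case: ifP => // _; exact: le_trans N1.
have mass : \sum_(x <- V) z x <= (1 + #|` U|%:R) * N.
  have zle x : z x <= 1 + (if x \in U then N else 0).
    by rewrite /z; case: ifP => _; rewrite ?addr0 // lerDr.
  apply: le_trans (ler_sum _ (fun x _ => zle x)) _.
  rewrite big_split /= sumr_const_fset -big_mkcond big_mem_fsetI (fsetIidPr UV) sumr_const_fset.
  by rewrite [leRHS]mulrDl mul1r lerD2l [leRHS]mulr_natl.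
have wz : #|` F|%:R * N ^+ j <= wgt z F.
  apply: cardfs_mul_le_sum => f fF; rewrite -big_mkcond big_mem_fsetI prodr_const_fset.
  by rewrite ler_weXn2l ?Fj.
apply: le_trans wz _; apply: (@le_trans _ _ (k`!%:R * wgt z F)).
  by rewrite ler_peMl ?wgt_ge0 // ler1n fact_gt0.
apply: le_trans (wgt_le_mass z0 FV) _.
by rewrite lerXn2r ?nnegrE ?sumr_ge0 // (le_trans _ mass) ?sumr_ge0.
Qed.

Variables (V U : {fset nat}) (w : nat -> R) (a b : R).
Hypotheses (UV : U `<=` V) (b_ge0 : 0 <= b) (b_le_a : b <= a).
Hypotheses (w_ge_b : {in V, forall x, b <= w x}) (w_ge_a : {in V `\` U, forall x, a <= w x}).

Lemma prod_ge_light_tail (e : {fset nat}) k : e `<=` V -> #|` e| = k.+1 ->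
  (#|` e `&` U| <= 1)%N -> b * a ^+ k <= \prod_(x <- e) w x.
Proof.
move=> eV ek eU; have a_ge0 := le_trans b_ge0 b_le_a.
apply: (@le_trans _ _ (\prod_(x <- e) (if x \in U then b else a))); last first.
  rewrite big_seq [leRHS]big_seq; apply: ler_prod => x /(fsubsetP eV) xV.
  case: ifPn => xU; first by rewrite b_ge0 w_ge_b.
  by rewrite a_ge0 w_ge_a // in_fsetD xU.
rewrite (bigID (mem U)) /=; under eq_bigr => x xU do rewrite xU.
under [X in _ <= _ * X]eq_bigr => x xU do rewrite (negPf xU).
rewrite big_mem_fsetI big_notin_fsetD !prodr_const_fset.
move: eU; have := cardfsID U e; rewrite ek; case: #|` e `&` U| => [|[|//]].
  by rewrite add0n => -> _; rewrite expr0 mul1r exprS ler_wpM2r ?exprn_ge0.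
by rewrite add1n => -[->].
Qed.

Lemma wgt_ge_light_tail F k : (forall x, 0 <= w x) -> (0 < #|` V|)%N -> F `<=` ksets V k.+2 ->
  (#|` F|%:R - (1 + #|` U|%:R) ^+ k.+2 * #|` V|%:R ^+ k) * (b * a ^+ k.+1) <= wgt w F.
Proof.
move=> w_ge0 V_gt0 FV; pose meets_twice e := (1 < #|` e `&` U|)%N.
pose crowded := [fset f in F | meets_twice f]; pose sparse := [fset f in F | ~~ meets_twice f].
have crowdedV : crowded `<=` ksets V k.+2.
  by apply: fsubset_trans FV; apply/fsubsetP => f; rewrite !inE => /andP[].
have F_split : #|` F|%:R = #|` crowded|%:R + #|` sparse|%:R :> R.
  by rewrite -natrD !card_fset_sum1 [in LHS](big_fsetID _ meets_twice).
have crowded_le : #|` crowded|%:R <= (1 + #|` U|%:R) ^+ k.+2 * #|` V|%:R ^+ k :> R.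
  have V2 : 0 < #|` V|%:R ^+ 2 :> R by rewrite exprn_gt0 // ltr0n.
  rewrite -(ler_pM2r V2) -mulrA -exprD addn2 -exprMn; apply: card_meeting_le => // f.
  by rewrite !inE => /andP[].
have ba0 : 0 <= b * a ^+ k.+1 by rewrite mulr_ge0 ?exprn_ge0 // (le_trans b_ge0).
apply: (@le_trans _ _ (#|` sparse|%:R * (b * a ^+ k.+1))).
  by rewrite ler_wpM2r //; lra.
have sparseF : sparse `<=` F by apply/fsubsetP => f; rewrite !inE => /andP[].
apply: le_trans (wgt_subset w_ge0 sparseF).
apply: cardfs_mul_le_sum => f.
rewrite !inE /= -leqNgt => /andP[/(fsubsetP FV) + fU].
by rewrite in_ksets => /andP[fV /eqP fk]; apply: prod_ge_light_tail.
Qed.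

End LightTail.

Lemma ffact_le_expn n k : (n ^_ k <= n ^ k)%N.
Proof.
elim: k => // k IH; rewrite ffactnSr expnSr; apply: leq_mul => //.
exact: leq_subr.
Qed.

(* The constants of the argument, [n] being the order of the complete hypergraph that
   maximality compares [G] with: [\sum_x w x ^ 2 <= 1 / (n - spread_defect r)], the degrees
   are at least [n ^ (r - 2) (n - degree_defect r) / (r - 1)!], the [tail_size r] lightest
   vertices are set apart, and beyond [order_bound r] the replacement of edges gains weight. *)
Definition spread_defect r := ('C(r, 2) * 'C(r.-1, 2))%N.

Definition degree_defect r := (2 * 'C(r, 2) + r.-1 * spread_defect r)%N.

Definition tail_size r := (2 * degree_defect r + spread_defect r + 3)%N.

Definition order_bound r :=
  (2 * (r.-1)`! * ((1 + tail_size r) ^ r * 2 ^ r.-2 + 'C(r, 2) ^ 2 * (2 * tail_size r) ^ r.-1))%N.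

Lemma natr_degree_defect (R : pzSemiRingType) r :
  (degree_defect r)%:R = 2 * 'C(r, 2)%:R + r.-1%:R * (spread_defect r)%:R :> R.
Proof. by rewrite /degree_defect natrD !natrM. Qed.

Section BalancedWeighting.
Variables (R : realType) (p n : nat) (V : {fset nat}) (G : {fset {fset nat}}) (w : nat -> R).
Local Notation r := p.+2.
Local Notation q := ('C(r, 2)%:R : R).
Local Notation K := ((spread_defect r)%:R : R).
Local Notation D := ((degree_defect r)%:R : R).
Hypotheses (n_large : (2 * degree_defect r < n)%N) (GV : G `<=` ksets V r).
Hypotheses (w_ge0 : forall x, 0 <= w x) (w_mass : \sum_(x <- V) w x = 1).
Hypothesis w_link : {in V, forall x, wgt w (link x G) = r%:R * wgt w G}.
Hypothesis w_ge : 1 - q / n%:R <= r`!%:R * wgt w G.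

Let n_gt0 : 0 < n%:R :> R. Proof. by rewrite ltr0n; lia. Qed.

Let q_ge1 : 1 <= q. Proof. by rewrite ler1n bin_gt0. Qed.

Let q_le_n : 2 * q <= n%:R.
Proof.
rewrite -natrM ler_nat; apply: leq_trans (leq_addr _ _ : _ <= degree_defect r)%N _.
by move: n_large; lia.
Qed.

Let K_le_n : K <= n%:R.
Proof.
rewrite ler_nat; apply: (@leq_trans (degree_defect r)); last by move: n_large; lia.
by rewrite /degree_defect /= mulSn; lia.
Qed.

Lemma fact_wgt_link x : x \in V -> p.+1`!%:R * wgt w (link x G) = r`!%:R * wgt w G.
Proof. by move=> xV; rewrite w_link // [in RHS]factS natrM; ring. Qed.

Lemma weight_le : {in V, forall x, w x <= q / n%:R}.
Proof.
move=> x xV; have := wgt_le_mass w_ge0 (link_subset_ksets xV GV).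
rewrite fact_wgt_link // (_ : \sum_(y <- V `\ x) w y = 1 - w x); last first.
  by rewrite sumr_fsetD ?fsub1set // w_mass big_seq_fset1.
have wx1 : w x <= 1 by rewrite -w_mass (big_fsetD1 x xV) lerDl sumr_ge0.
have : (1 - w x) ^+ p.+1 <= 1 - w x.
  by rewrite exprS ler_piMr ?subr_ge0 // exprn_ile1 ?subr_ge0 // gerBl.
by move: w_ge; lra.
Qed.

Lemma sum_sqr_weight_le : (n%:R - K) * \sum_(x <- V) w x ^+ 2 <= 1.
Proof.
set P := \sum_(x <- V) _.
have wgt_le : r`!%:R * wgt w G <= distinct_wgt w V r by rewrite ler_wpM2l ?wgt_subset.
have := le_trans (le_trans w_ge wgt_le) (distinct_wgt_le w_ge0 w_mass weight_le r).
rewrite lerD2l lerN2 -mulrA ler_pM2l; last exact: lt_le_trans ltr01 q_ge1.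
rewrite -(ler_pM2l n_gt0) divff ?gt_eqF // (_ : n%:R * _ = (n%:R - K) * P) //.
by rewrite /P /spread_defect natrM /=; field; rewrite gt_eqF.
Qed.

Lemma sqr_sum_weight_le A : A `<=` V ->
  (n%:R - K) * (\sum_(x <- A) w x) ^+ 2 <= #|` A|%:R.
Proof.
move=> AV; have nK : 0 <= n%:R - K by rewrite subr_ge0 K_le_n.
apply: le_trans (ler_wpM2l nK (sqr_sum_le_size _ _)) _.
rewrite mulrCA ler_piMr // (le_trans _ sum_sqr_weight_le) // ler_wpM2l //.
by rewrite ler_sum_fsubset // => x; exact: sqr_ge0.
Qed.

(* If the weights on [U] were below [1 / (2 n #|` U|)], then [V `\` U] would carry mass at
   least [1 - 1 / (2 n)], too much for fewer than [n - spread_defect r - 1] vertices. *)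
Lemma tail_weight_ge U (a : R) : U `<=` V -> #|` U| = tail_size r ->
  (#|` V| <= n + 2 * degree_defect r + 1)%N -> {in U, forall x, w x <= a} ->
  1 <= 2 * n%:R * (tail_size r)%:R * a.
Proof.
move=> UV cU cV wU; rewrite leNgt; apply/negP => small.
have tail_mass : \sum_(x <- U) w x <= (tail_size r)%:R * a.
  by rewrite -cU; apply: sum_le_cardfs_mul.
have := sqr_sum_weight_le (fsubsetDl V U).
rewrite (sumr_fsetD _ UV) w_mass cardfsDS // natrB ?fsubset_leq_card // cU.
have : #|` V|%:R <= n%:R + 2 * D + 1 by rewrite -natrM -natrD natr1 ler_nat -(addn1 (n + _)).
rewrite [(tail_size r)%:R](_ : _ = 2 * D + K + 3); last by rewrite -natrM -!natrD.
set S := \sum_(x <- U) w x => cVR.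
have S0 : 0 <= S by rewrite sumr_ge0.
have nS : 2 * n%:R * S < 1.
  by apply: le_lt_trans small; rewrite -[leRHS]mulrA ler_wpM2l // mulr_ge0.
have K0 : 0 <= K * S by rewrite mulr_ge0.
have S2 : 0 <= (n%:R - K) * S ^+ 2 by rewrite mulr_ge0 ?sqr_ge0 // subr_ge0 K_le_n.
by lra.
Qed.

(* Cauchy-Schwarz over the edges through [x]. *)
Lemma sqr_wgt_le_degree x : x \in V ->
  (r`!%:R * wgt w G) ^+ 2 <=
  #|` link x G|%:R * p.+1`!%:R * (\sum_(y <- V) w y ^+ 2) ^+ p.+1.
Proof.
move=> xV; rewrite -(fact_wgt_link xV); set f : R := p.+1`!%:R; set d : R := _%:R.
have linkV : link x G `<=` ksets V p.+1.
  exact: fsubset_trans (link_subset_ksets xV GV) (ksets_subset _ (fsubD1set V x)).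
have prod_sqr := wgt_le_mass (fun y => sqr_ge0 (w y)) linkV.
have cauchy : wgt w (link x G) ^+ 2 <= d * wgt (fun y => w y ^+ 2) (link x G).
  rewrite [X in _ * X](eq_bigr (fun e : {fset nat} => (\prod_(y <- e) w y) ^+ 2)).
    exact: sqr_sum_le_size.
  by move=> e _; rewrite prodrXl.
have f0 : 0 <= f by [].
have d0 : 0 <= d by [].
have := ler_wpM2l (mulr_ge0 f0 f0) cauchy; have := ler_wpM2l (mulr_ge0 d0 f0) prod_sqr.
by rewrite -/f exprMn; lra.
Qed.

Lemma degree_ge x : x \in V -> n%:R ^+ p * (n%:R - D) <= p.+1`!%:R * #|` link x G|%:R.
Proof.
move=> xV; set P := \sum_(x <- V) w x ^+ 2; set d := #|` _|%:R; set f : R := _`!%:R.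
set alpha := q / n%:R; set beta := K / n%:R.
have alpha0 : 0 <= alpha by rewrite divr_ge0.
have beta01 : 0 <= beta <= 1 by rewrite divr_ge0 //= ler_pdivrMr // mul1r K_le_n.
have alpha1 : 2 * alpha <= 1 by rewrite mulrA ler_pdivrMr // mul1r q_le_n.
have wgt_sqr_ge : 1 - 2 * alpha <= (r`!%:R * wgt w G) ^+ 2.
  have alpha_le1 : 0 <= 1 - alpha by lra.
  have : (1 - alpha) ^+ 2 <= (r`!%:R * wgt w G) ^+ 2.
    by rewrite lerXn2r ?nnegrE // (le_trans alpha_le1 w_ge).
  by have := sqr_ge0 alpha; lra.
have spread : n%:R ^+ p.+1 * (P ^+ p.+1 * (1 - beta) ^+ p.+1) <= 1.
  rewrite -!exprMn exprn_ile1 //.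
    by rewrite !mulr_ge0 // ?sumr_ge0 // => [? _|]; rewrite ?sqr_ge0 //; lra.
  suff -> : n%:R * (P * (1 - beta)) = (n%:R - K) * P by exact: sum_sqr_weight_le.
  by rewrite /beta; field; rewrite gt_eqF.
have -> : n%:R ^+ p * (n%:R - D) = n%:R ^+ p.+1 * (1 - 2 * alpha - p.+1%:R * beta).
  by rewrite natr_degree_defect /= /alpha /beta exprS; field; rewrite gt_eqF.
have rescaled : 1 - 2 * alpha - p.+1%:R * beta <= (1 - 2 * alpha) * (1 - beta) ^+ p.+1.
  have := ler_wpM2l _ (bernoulli_ge p.+1 beta01) => /(_ (1 - 2 * alpha)).
  rewrite subr_ge0 => /(_ alpha1) /(le_trans _); apply.
  have : 0 <= 2 * alpha * (p.+1%:R * beta) by rewrite !mulr_ge0 //; lra.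
  by lra.
have rest0 : 0 <= (1 - beta) ^+ p.+1 by rewrite exprn_ge0 // subr_ge0; case/andP: beta01.
have fd0 : 0 <= f * d by rewrite mulr_ge0.
apply: le_trans (ler_wpM2l (exprn_ge0 p.+1 (ltW n_gt0)) rescaled) _.
apply: (@le_trans _ _ (f * d * (n%:R ^+ p.+1 * (P ^+ p.+1 * (1 - beta) ^+ p.+1)))); last first.
  exact: ler_piMr.
rewrite [leRHS]mulrCA ler_wpM2l ?exprn_ge0 // [leRHS]mulrA ler_wpM2r // (le_trans wgt_sqr_ge) //.
by rewrite [f * d]mulrC sqr_wgt_le_degree.
Qed.

(* Double counting of the incidences between vertices and edges. *)
Lemma card_vertices_le : (#|` G| <= 'C(n.+1, r))%N ->
  (#|` V| <= n + 2 * degree_defect r + 1)%N.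
Proof.
move=> Gn; have np : 0 < n%:R ^+ p :> R by rewrite exprn_gt0.
have incidences : \sum_(x <- V) #|` link x G|%:R = r%:R * #|` G|%:R :> R.
  have := sum_wgt_link (fun=> 1 : R) GV; rewrite wgt1 => <-.
  by apply: eq_bigr => x _; rewrite wgt1 mul1r.
have low : #|` V|%:R * (n%:R ^+ p * (n%:R - D)) <= r`!%:R * #|` G|%:R.
  rewrite factS natrM mulrAC -incidences mulr_suml.
  by apply: cardfs_mul_le_sum => x xV; rewrite [leRHS]mulrC degree_ge.
have high : r`!%:R * #|` G|%:R <= n.+1%:R * n%:R ^+ p.+1 :> R.
  rewrite -natrX -!natrM ler_nat; apply: (@leq_trans (r`! * 'C(n.+1, r))).
    by rewrite leq_mul2l Gn orbT.
  by rewrite mulnC bin_ffact ffactSS leq_mul2l ffact_le_expn orbT.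
have {low high} : (#|` V| * (n - degree_defect r) <= n.+1 * n)%N.
  rewrite -(ler_nat R) !natrM natrB; last by move: n_large; lia.
  rewrite -(ler_pM2l np) mulrCA (le_trans low) // (le_trans high) //.
  by rewrite exprSr mulrCA.
by move: n_large; set e := degree_defect r; nia.
Qed.

Lemma degree_ge_half x : x \in V -> n%:R ^+ p.+1 <= 2 * p.+1`!%:R * #|` link x G|%:R :> R.
Proof.
move=> /degree_ge; have : 0 <= n%:R ^+ p * (n%:R - 2 * D).
  by rewrite mulr_ge0 ?exprn_ge0 // subr_ge0 -natrM ler_nat ltnW.
by rewrite exprSr; lra.
Qed.

Section Replacement.
Variables (x : nat) (U : {fset nat}) (F : {fset {fset nat}}) (a : R).
Local Notation B := ((tail_size r)%:R : R).
Hypotheses (Gn : (#|` G| <= 'C(n.+1, r))%N) (xV : x \in V) (wx_gt0 : 0 < w x).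
Hypothesis wx_min : {in V, forall y, w x <= w y}.
Hypotheses (UV : U `<=` V) (cU : #|` U| = tail_size r) (wx_le_a : w x <= a).
Hypotheses (wU : {in U, forall y, w y <= a}) (wVU : {in V `\` U, forall y, a <= w y}).
Hypotheses (FV : F `<=` ksets V r) (cF : #|` F| = #|` link x G|).
Hypothesis wF : wgt w F <= q * w x ^+ 2 * wgt w G.

Lemma replacement_gain_le :
  n%:R * (#|` link x G|%:R - (1 + B) ^+ r * (2 * n%:R) ^+ p) * a ^+ p.+1 <= q ^+ 2.
Proof.
have a_ge0 : 0 <= a by rewrite (le_trans (ltW wx_gt0)).
have V_gt0 : (0 < #|` V|)%N by rewrite cardfs_gt0; apply/fset0Pn; exists x.
have wG_le1 : wgt w G <= 1.
  have := wgt_le_mass w_ge0 GV; rewrite w_mass expr1n; apply: le_trans.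
  by rewrite ler_peMl ?wgt_ge0 // ler1n fact_gt0.
have cV : #|` V|%:R ^+ p <= (2 * n%:R) ^+ p :> R.
  rewrite lerXn2r ?nnegrE ?mulr_ge0 // -natrM ler_nat (leq_trans (card_vertices_le Gn)) //.
  by rewrite [leqRHS]mul2n -addnn -addnA leq_add2l addn1.
have := wgt_ge_light_tail UV (ltW wx_gt0) wx_le_a wx_min wVU w_ge0 V_gt0 FV.
rewrite cU cF => /le_trans /(_ wF) gain.
have few : (1 + B) ^+ r * #|` V|%:R ^+ p <= (1 + B) ^+ r * (2 * n%:R) ^+ p.
  by rewrite ler_wpM2l // exprn_ge0 // addr_ge0.
set d : R := #|` link x G|%:R in gain *.
have net : (d - (1 + B) ^+ r * (2 * n%:R) ^+ p) * a ^+ p.+1 <= q * w x.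
  rewrite -(ler_pM2r wx_gt0) -mulrA [a ^+ _ * _]mulrC.
  apply: (@le_trans _ _ (q * w x ^+ 2 * wgt w G)); last first.
    by rewrite -[leRHS]mulrA -expr2 ler_piMr // mulr_ge0 // sqr_ge0.
  by apply: le_trans gain; rewrite ler_wpM2r ?mulr_ge0 ?exprn_ge0 // lerB.
rewrite -mulrA (le_trans (ler_wpM2l (ltW n_gt0) net)) // mulrCA expr2 ler_wpM2l //.
by rewrite -ler_pdivlMl // mulrC weight_le.
Qed.

Lemma le_order_bound : (n <= order_bound r)%N.
Proof.
have a_ge0 : 0 <= a by rewrite (le_trans (ltW wx_gt0)).
set f : R := p.+1`!%:R; set d : R := #|` link x G|%:R.
set M : R := (1 + B) ^+ r * 2 ^+ p; set C : R := (2 * B) ^+ p.+1.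
set Y : R := n%:R ^+ p * a ^+ p.+1.
have C0 : 0 <= C by rewrite exprn_ge0 // mulr_ge0.
have M0 : 0 <= M by rewrite mulr_ge0 ?exprn_ge0 ?addr_ge0.
have bound_E : (order_bound r)%:R = 2 * f * (M + q ^+ 2 * C) :> R.
  by rewrite /order_bound /= natrM natrM natrD natrM natrM !natrX natrD natrM.
have tail_mass : 1 <= C * (n%:R * Y).
  rewrite (_ : C * _ = (2 * n%:R * B * a) ^+ p.+1); last first.
    by rewrite /C /Y [n%:R * _]mulrA -exprS mulrA -!exprMn; congr (_ ^+ _); ring.
  by rewrite exprn_ege1 // (tail_weight_ge UV cU (card_vertices_le Gn) wU).
have gain : (n%:R - 2 * f * M) * (n%:R * Y) <= 2 * f * q ^+ 2.
  have degree := degree_ge_half xV; rewrite exprS -/f -/d in degree.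
  have weighted_ge0 : 0 <= n%:R * a ^+ p.+1 by rewrite mulr_ge0 ?exprn_ge0.
  have f2 : 0 <= 2 * f by rewrite mulr_ge0.
  have := ler_wpM2r weighted_ge0 degree; have := ler_wpM2l f2 replacement_gain_le.
  by rewrite -/d exprMn /M /Y; lra.
rewrite -(ler_nat R) bound_E.
have [small|large] := lerP n%:R (2 * f * M).
  by rewrite (le_trans small) // ler_wpM2l ?mulr_ge0 // lerDl mulr_ge0 ?sqr_ge0.
have := ler_wpM2l C0 gain; rewrite -subr_gt0 in large.
by have := ler_wpM2l (ltW large) tail_mass; lra.
Qed.

End Replacement.

End BalancedWeighting.

Lemma max_nonisolated (G : {fset {fset nat}}) x : nonisolated G x ->
  exists T, [/\ (x <= T)%N, nonisolated G T &
                forall e y, e \in G -> y \in e -> (y <= T)%N].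
Proof.
move=> [e0 e0G xe0]; pose used y := has (fun e : {fset nat} => y \in e) (enum_fset G).
have some_used : exists y, used y by exists x; apply/hasP; exists e0.
have used_le y : used y -> (y <= \max_(e <- G) \max_(z <- e) z)%N.
  move=> /hasP[e eG ye]; apply: (@leq_trans (\max_(z <- e) z)).
    exact: (@leq_bigmax_seq _ _ xpredT id).
  exact: (@leq_bigmax_seq _ _ xpredT (fun e : {fset nat} => \max_(z <- e) z)).
case: (ex_maxnP some_used used_le) => T /hasP[eT eTG TeT] Tmax.
exists T; split; first by apply: Tmax; apply/hasP; exists e0.
  by exists eT.
by move=> e y eG ye; apply: Tmax; apply/hasP; exists e.
Qed.

Lemma rgraph_subset_segment r T (G : {fset {fset nat}}) : is_rgraph r G ->
  (forall e y, e \in G -> y \in e -> (y <= T)%N) -> G `<=` ksets (segment T) r.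
Proof.
move=> rG GT; apply/fsubsetP => e eG; have [er e0] := rG e eG.
rewrite in_ksets er eqxx andbT; apply/fsubsetP => y ye.
by rewrite in_segment (GT e) // andbT lt0n; apply: contraNneq e0 => <-.
Qed.

Lemma decreasing_wW (R : realType) (w : nat -> R) i j : decreasing_w w ->
  (0 < i)%N -> (i <= j)%N -> w j <= w i.
Proof. by move=> wdec i0; rewrite leq_eqVlt => /predU1P[->|/(wdec i j i0)]. Qed.

Section DecreasingMaximalWeighting.
Variables (R : realType) (p n T : nat) (G : {fset {fset nat}}) (w : nat -> R).
Local Notation r := p.+2.
Hypotheses (n_large : (tail_size r + order_bound r < n)%N).
Hypotheses (GT : G `<=` ksets (segment T) r) (cG : ('C(n, r) <= #|` G| <= 'C(n.+1, r))%N).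
Hypotheses (Gmax : lagrangian_maximal R r G) (ww : weighting w) (wG : wgt w G = lagrangian R G).
Hypotheses (wdec : decreasing_w w) (T_gt0 : (0 < T)%N) (wT : 0 < w T).

Let segment0 : 0%N \notin segment T. Proof. by rewrite in_segment. Qed.

Let w_ge0 x : 0 <= w x. Proof. by case: ww => _ []. Qed.

Let defect_lt : (2 * degree_defect r < n)%N.
Proof.
by apply: leq_ltn_trans n_large; rewrite /tail_size -2!addnA leq_addr.
Qed.

Let q_lt_n : 'C(r, 2)%:R < n%:R :> R.
Proof.
rewrite ltr_nat; apply: leq_ltn_trans defect_lt.
by rewrite /degree_defect mulnDr mulnA (leq_trans _ (leq_addr _ _)) // leq_pmull.
Qed.

Let w_ge : 1 - 'C(r, 2)%:R / n%:R <= r`!%:R * wgt w G.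
Proof. by rewrite wG extremal_lagrangian_ge // (leq_ltn_trans _ n_large). Qed.

Let lagrangian_gt0 : 0 < lagrangian R G.
Proof.
have n_gt0 : 0 < n%:R :> R by rewrite ltr0n (leq_ltn_trans _ n_large).
rewrite -wG -(pmulr_rgt0 _ (_ : 0 < r`!%:R)) ?ltr0n ?fact_gt0 //.
by apply: lt_le_trans w_ge; rewrite subr_gt0 ltr_pdivrMr // mul1r q_lt_n.
Qed.

Let w_mass : \sum_(x <- segment T) w x = 1.
Proof. exact: (maximal_weighting_mass segment0 GT _ ww wG lagrangian_gt0). Qed.

Let w_min : {in segment T, forall x, w T <= w x}.
Proof. by move=> x; rewrite in_segment => /andP[x0 xT]; exact: decreasing_wW. Qed.

Let w_link : {in segment T, forall x, wgt w (link x G) = r%:R * wgt w G}.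
Proof.
move=> x xV; rewrite [in RHS]wG; apply: (wgt_link_maximal segment0 GT) => //.
exact: lt_le_trans (w_min xV).
Qed.

Lemma max_vertex_le : (T <= n.+1)%N.
Proof.
rewrite leqNgt; apply/negP => n_lt_T.
have TV : T \in segment T by rewrite in_segment T_gt0 leqnn.
have cGn : (#|` G| <= 'C(n.+1, r))%N by case/andP: cG.
have tail_lt : (tail_size r < T)%N.
  by apply: leq_ltn_trans (ltn_trans n_large (ltnW n_lt_T)); exact: leq_addr.
have wT_lt1 : w T < 1.
  have := weight_le GT w_ge0 w_mass w_link w_ge TV => /le_lt_trans; apply.
  by rewrite ltr_pdivrMr ?mul1r ?q_lt_n // ltr0n (leq_ltn_trans _ n_large).
have [|F FV cF] := exists_replacement_edges TV GT.
  by rewrite card_segment (leq_trans cGn) // leq_bin2l // -ltnS prednK.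
have := wgt_replacement_le segment0 GT Gmax w_ge0 w_mass wG TV _ FV cF.
rewrite wT wT_lt1 -wG => /(_ isT) wF.
set m := (T - tail_size r)%N.
have m_gt0 : (0 < m)%N by rewrite subn_gt0.
have mT : segment m `<=` segment T by rewrite segment_subset ?leq_subr.
have mV : m \in segment T by apply: (fsubsetP mT); rewrite in_segment m_gt0 leqnn.
have card_tail : #|` segment T `\` segment m| = tail_size r.
  by rewrite cardfsDS // !card_segment subKn // ltnW.
have w_tail : {in segment T `\` segment m, forall y, w y <= w m}.
  move=> y; rewrite in_fsetD !in_segment => /andP[+ /andP[y0 _]].
  by rewrite y0 -ltnNge => /ltnW; exact: decreasing_wW.
have w_head : {in segment T `\` (segment T `\` segment m), forall y, w m <= w y}.
  by move=> y; rewrite fsetDK // in_segment => /andP[y0 yh]; exact: decreasing_wW.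
have FT : F `<=` ksets (segment T) r.
  by apply: fsubset_trans (fsubset_trans FV (fsubsetDl _ _)) (ksets_subset _ (fsubD1set _ _)).
have := le_order_bound defect_lt GT w_ge0 w_mass w_link w_ge cGn TV wT w_min (fsubsetDl _ _)
  card_tail (w_min mV) w_tail w_head FT cF wF.
by apply/negP; rewrite -ltnNge (leq_ltn_trans _ n_large) // leq_addl.
Qed.

End DecreasingMaximalWeighting.

Theorem theorem4p1 (R : realType) (r : nat) (hr : (3 <= r)%N) :
  exists t0 : nat, forall t : nat, (t0 <= t)%N ->
    forall G : {fset {fset nat}}, is_rgraph r G ->
    ('C(t.-1, r) <= #|` G| <= 'C(t, r))%N ->
    (forall H : {fset {fset nat}}, is_rgraph r H -> #|` H| = #|` G| ->
        lagrangian R H <= lagrangian R G) ->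
    forall w : nat -> R, weighting w -> wgt w G = lagrangian R G ->
    decreasing_w w -> (forall x, nonisolated G x -> 0 < w x) ->
    within_t t G.
Proof.
case: r hr => [|[|p]] // _; exists (tail_size p.+2 + order_bound p.+2).+2 => -[//|n] n_large.
move=> G rG cG Gmax w ww wG wdec wpos e eG x xe.
have [_ e0] := rG e eG; have [T [xT TG GT]] : _ := max_nonisolated (ex_intro2 _ _ e eG xe).
have x_gt0 : (0 < x)%N by rewrite lt0n; apply: contraNneq e0 => <-.
rewrite x_gt0 (leq_trans xT) //.
exact: (max_vertex_le n_large (rgraph_subset_segment rG GT) cG Gmax ww wG wdec
         (leq_trans x_gt0 xT) (wpos T TG)).
Qed.
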